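(* Let $G=(V,E,w)$ be a weighted graph, let $a<b$ be real numbers, and let $u\colon V\times[a,b]\to\mathbb{R}$ be a function such that $u(x,\cdot)$ is $C^1$ for every $x\in V$ and $u(\cdot,t),\ \partial_t u(\cdot,t)\in W^{1,2}_\mu(V)$ for every $t\in[a,b]$. Suppose $\partial_t u(x,t)=\Delta u(x,t)+c(x)u(x,t)$ on $V\times[a,b]$ for some bounded function $c\colon V\to\mathbb{R}$. If $u(\cdot,b)\equiv 0$, then $u\equiv 0$ on $V\times[a,b]$.
   Context: A weighted graph $G=(V,E,w)$ consists of a (possibly infinite) vertex set $V$, an edge set $E\subseteq V\times V$ and a weight function $w$ on $E$ with $w_{xy}=w(x,y)>0$ for $(x,y)\in E$; $x\sim y$ means $(x,y)\in E$. All graphs are undirected ($(x,y)\in E$ iff $(y,x)\in E$, and $w_{xy}=w_{yx}$), locally finite and connected. The vertex weight is $\mu(x)=\sum_{y\sim x}w_{xy}$ and the Laplacian is $\Delta f(x)=\sum_{y\sim x}\frac{w_{xy}}{\mu(x)}(f(y)-f(x))$, acting in the $x$ variable. The function space is $W^{1,2}_\mu(V)=\{f\colon V\to\mathbb{R}:\sum_{x\in V}f(x)^2\mu(x)<\infty\}$. *)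

(* Defs.v *)
From HB Require Import structures.
From mathcomp Require Import all_boot all_order all_algebra.
From mathcomp Require Import all_classical all_reals all_analysis.

Set Implicit Arguments.
Unset Strict Implicit.
Unset Printing Implicit Defensive.

Import Order.TTheory GRing.Theory Num.Theory.
Import numFieldNormedType.Exports.

Local Open Scope classical_set_scope.
Local Open Scope ring_scope.

(* Undirected, locally finite, connected weighted graphs on a vertex set V of
   arbitrary cardinality. Loops are allowed, since E is any symmetric subset of
   V x V. The weight is a total function, but its values off the edge set are
   unconstrained and never used. *)
Record weighted_graph (R : realType) (V : choiceType) := WeightedGraph {
  edge : rel V;
  weight : V -> V -> R;
  edge_sym : forall x y, edge x y = edge y x;
  weight_gt0 : forall x y, edge x y -> 0 < weight x y;
  weight_sym : forall x y, edge x y -> weight x y = weight y x;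
  edge_locally_finite : forall x, finite_set [set y | edge x y];
  edge_connected : forall x y, exists2 p : seq V, path edge x p & last x p = y
}.

Definition vertex_weight (R : realType) (V : choiceType)
    (G : weighted_graph R V) (x : V) : R :=
  \sum_(y \in [set y | edge G x y]) weight G x y.

Definition laplacian (R : realType) (V : choiceType)
    (G : weighted_graph R V) (f : V -> R) (x : V) : R :=
  \sum_(y \in [set y | edge G x y])
    weight G x y / vertex_weight G x * (f y - f x).

Definition W12 (R : realType) (V : choiceType)
    (G : weighted_graph R V) : set (V -> R) :=
  [set f | (\esum_(x in [set: V]) (f x ^+ 2 * vertex_weight G x)%:E < +oo)%E].

(* Derivatives of a function on the subset A of R: the difference quotients
   only involve points of A, so that for A = `[a, b] the derivative is the
   one-sided one at a and at b, and nothing depends on f outside A. *)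
Definition diff_quotient (R : realType) (f : R -> R) (t s : R) : R :=
  (f s - f t) / (s - t).

Definition derivable_within (R : realType) (A : set R) (f : R -> R) (t : R) :=
  cvg (diff_quotient f t s @[s --> within A t^']).

Definition derive_within (R : realType) (A : set R) (f : R -> R) (t : R) : R :=
  lim (diff_quotient f t s @[s --> within A t^']).

Definition C1_within (R : realType) (A : set R) (f : R -> R) : Prop :=
  (forall t, A t -> derivable_within A f t) /\
  {within A, continuous (derive_within A f)}.

(* Main.v *)
(* The operator A = Delta + c is bounded on l^2(mu): with D = 8 + 2K^2 and
   |c| <= K, ||A f||^2 <= D ||f||^2. The equation makes u(x, .) smooth, with
   k-th derivative (A^k u)(x), so h_k(t) = (A^k u(., t))(x) / D^k satisfies
   h_k' = D h_(k+1), vanishes at b, and sup_k |h_k(t)| is finite for each t.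
   No uniformity in t is assumed, so Gronwall's lemma is not available directly.
   On an interval of length at most 1/(2D) the mean value theorem gives
   S <= n + S/2, where S is the supremum of all |h_k| over the interval and n a
   bound at one of its points, so S <= 2n as soon as S is finite. A Baire
   argument in the style of Pringsheim and Boas, applied to the set of points
   near which the h_k are not uniformly bounded, shows that S is always finite,
   and zero then propagates from b to all of [a, b]. *)
Require Import Defs.
From mathcomp Require Import all_boot all_order all_algebra.
From mathcomp Require Import all_classical all_reals all_analysis.
From mathcomp Require Import ring lra.

Set Implicit Arguments.
Unset Strict Implicit.
Unset Printing Implicit Defensive.

Import Order.TTheory GRing.Theory Num.Theory.
Import numFieldNormedType.Exports.

Local Open Scope classical_set_scope.
Local Open Scope ring_scope.

(** * Derivatives within a subset of the line *)

(** Clearing the denominator makes the estimate trivial at [s = t], so a full neighbourhood can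
    replace the punctured one. *)
Lemma diff_quotient_cvgP (R : realType) (A : set R) (f : R -> R) (t l : R) :
  diff_quotient f t s @[s --> within A t^'] --> l <->
  forall e, 0 < e ->
    \forall s \near t, A s -> `|f s - f t - l * (s - t)| <= e * `|s - t|.
Proof.
have eqP s e : s != t -> (`|l - diff_quotient f t s| <= e) =
    (`|f s - f t - l * (s - t)| <= e * `|s - t|).
  move=> st; have st0 : s - t != 0 by rewrite subr_eq0.
  rewrite -ler_pdivrMr ?normr_gt0// -normf_div distrC /diff_quotient.
  by congr (`| _ | <= _); field.
split=> [/cvgrPdist_le dq e e0|dq].
  have H : \forall s \near t, s != t -> A s -> `|l - diff_quotient f t s| <= e.
    exact: dq.
  near=> s => As; have [->|st] := eqVneq s t.
    by rewrite !subrr mulr0 subr0 normr0 mulr0.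
  by rewrite -eqP//; move: st As; near: s; exact: H.
apply/cvgrPdist_le => e e0; have H := dq e e0.
suff : \forall s \near t, s != t -> A s -> `|l - diff_quotient f t s| <= e by [].
by near=> s => st As; rewrite eqP//; move: As; near: s.
Unshelve. all: by end_near. Qed.

Lemma diff_quotient_continuous (R : realType) (A : set R) (f f' : R -> R) :
  (forall t, A t -> diff_quotient f t s @[s --> within A t^'] --> f' t) ->
  {within A, continuous f}.
Proof.
move=> df; apply/subspace_continuousP => t At.
have /diff_quotient_cvgP /(_ _ ltr01) := df t At; rewrite ?near_simpl => dft.
apply/cvgrPdist_le => e e0.
suff : \forall s \near t, A s -> `|f t - f s| <= e by [].
have n0 : 0 < 1 + `|f' t| by rewrite ltr_pwDl.
near=> s => As.
have : `|f s - f t - f' t * (s - t)| <= 1 * `|s - t|.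
  by move: As; near: s.
have st : `|t - s| <= e / (1 + `|f' t|).
  by near: s; apply: cvgr_dist_le; rewrite ?divr_gt0.
move=> h; rewrite distrC.
rewrite -(subrK (f' t * (s - t)) (f s - f t)) (le_trans (ler_normD _ _))//.
rewrite (le_trans (lerD h (lexx _)))// normrM -mulrDl.
by rewrite -ler_pdivlMl// mulrC distrC.
Unshelve. all: by end_near. Qed.

Lemma diff_quotient_is_derive (R : realType) (A : set R) (f : R -> R) (t l : R) :
  nbhs t A -> diff_quotient f t s @[s --> within A t^'] --> l ->
  is_derive t 1 f l.
Proof.
move=> nA /diff_quotient_cvgP df.
suff dl : h^-1 *: (f (h *: 1 + t) - f t) @[h --> (0:R)^'] --> l.
  by split; [apply/cvg_ex; exists l | exact/cvg_lim].
apply/cvgrPdist_le => e e0.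
have := df e e0; rewrite ?near_simpl => dfe.
have {}dfe : \forall s \near t, `|f s - f t - l * (s - t)| <= e * `|s - t|.
  by near=> s; have : A s; [near: s | near: s].
have H : \forall h \near (0:R),
    `|f (h + t) - f t - l * h| <= e * `|h|.
  have : (h + t) @[h --> (0:R)] --> t.
    by rewrite -[X in _ --> X]add0r; apply: cvgD; [exact: cvg_id|exact: cvg_cst].
  move=> /(_ _ dfe); rewrite /= ?near_simpl => {}dfe.
  near=> h; rewrite -[X in l * X](addrK t h) -[X in e * `|X|](addrK t h).
  by near: h.
rewrite ?near_simpl; near=> h.
have h0 : h != 0 by near: h; exact: nbhs_dnbhs_neq.
have -> : l - h^-1 *: (f (h%:A + t) - f t) = - (f (h + t) - f t - l * h) / h.
  by rewrite /GRing.scale/= mulr1; field.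
rewrite normrM normrN normfV ler_pdivrMr ?normr_gt0//.
by near: h; exact: nbhs_dnbhs.
Unshelve. all: by end_near. Qed.

(** Inside []x, y[] the relative derivative is the ordinary one; the endpoints enter only through
    continuity. *)
Lemma diff_quotient_mean_value (R : realType) (a b : R) (f f' : R -> R) :
  (forall t, t \in `[a, b] ->
    diff_quotient f t s @[s --> within `[a, b] t^'] --> f' t) ->
  forall (M x y : R), a <= x -> x <= y -> y <= b ->
  (forall t, t \in `[x, y] -> `|f' t| <= M) ->
  `|f y - f x| <= M * (y - x).
Proof.
move=> df M x y ax xy yb bd.
have [||z zxy ->] := @MVT_segment R f f' x y xy.
- move=> t; rewrite in_itv/= => /andP[xt ty].
  apply: (@diff_quotient_is_derive _ `[a, b]).
    have : t \in `]a, b[.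
      by rewrite in_itv/= (le_lt_trans ax xt) (lt_le_trans ty yb).
    move=> tab; apply: filterS (near_in_itvoo tab) => z.
    exact: subset_itv_oo_cc.
  by apply: df; rewrite in_itv/=; lra.
- apply: (@continuous_subspaceW _ _ _ `[a, b]).
    by move=> z /=; rewrite !in_itv/=; lra.
  by apply: diff_quotient_continuous => t tab; exact: df.
- rewrite normrM (ger0_norm (_ : 0 <= y - x)) ?subr_ge0//.
  by rewrite ler_wpM2r ?subr_ge0// bd.
Qed.

(** * Absorption for chains of derivatives *)

(** [M] makes the supremum of all [|h k x|] over [I] finite; the conclusion replaces it by twice the
    bound at the single point [p]. *)
Lemma interval_absorption (R : realType) (a b C n M p : R) (I : set R)
    (h : nat -> R -> R) :
  0 <= C ->
  (forall k t, t \in `[a, b] ->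
    diff_quotient (h k) t s @[s --> within `[a, b] t^'] --> C * h k.+1 t) ->
  is_interval I -> I `<=` `[a, b] ->
  (forall x y, I x -> I y -> 2 * C * (y - x) <= 1) ->
  (forall x k, I x -> `|h k x| <= M) ->
  I p -> (forall k, `|h k p| <= n) ->
  forall x k, I x -> `|h k x| <= 2 * n.
Proof.
move=> C0 dh itvI Iab Ilen IM Ip hp.
have incr x y B k : I x -> I y -> x <= y -> 0 <= B ->
    (forall z j, I z -> `|h j z| <= B) -> `|h k y - h k x| <= B / 2.
  move=> Ix Iy xy B0 IB.
  have /itvP xab := Iab _ Ix; have /itvP yab := Iab _ Iy.
  apply: (@le_trans _ _ (C * B * (y - x))).
    apply: (@diff_quotient_mean_value _ a b (h k) (fun t => C * h k.+1 t)) => //.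
    - by move=> t; exact: dh.
    - by rewrite xab.
    - by rewrite yab.
    - move=> t; rewrite in_itv/= => xty; rewrite normrM ger0_norm//.
      by rewrite ler_wpM2l// IB//; exact: itvI xty.
  by have := Ilen _ _ Ix Iy; nra.
have step B x k : 0 <= B -> (forall z j, I z -> `|h j z| <= B) -> I x ->
    `|h k x| <= n + B / 2.
  move=> B0 IB Ix; rewrite -(subrK (h k p) (h k x)) addrC.
  rewrite (le_trans (ler_normD _ _))// lerD//.
  by have [xp|px] := leP x p; [rewrite distrC|]; apply: incr => //; exact: ltW.
pose S := [set `|h z.1 z.2| | z in [set z | I z.2]].
have S0 : S !=set0 by exists `|h 0 p|; exists (0%N, p).
have Sub : ubound S M by move=> _ [[k x] /= Ix <-]; exact: IM.
have hS z j : I z -> `|h j z| <= sup S.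
  by move=> Iz; apply: ub_le_sup; [exists M | exists (j, z)].
have supS0 : 0 <= sup S := le_trans (normr_ge0 _) (hS p 0%N Ip).
have : sup S <= n + sup S / 2.
  by apply: ge_sup => // _ [[k x] /= Ix <-]; exact: step.
by move=> Sn x k Ix; have := hS x k Ix; lra.
Qed.

(** * Baire category and compactness *)

(** If every [E n] had empty interior in [K], there would be nested closed balls centred in [K], the
    one of index [m + 1] missing [E m] on [K]; a cluster point of the centres would lie in no
    [E n]. *)
Lemma compact_Baire (R : realType) (K : set R) (E : nat -> set R) :
  compact K -> K !=set0 ->
  (forall n t, K t -> ~ E n t -> \forall x \near t, K x -> ~ E n x) ->
  K `<=` \bigcup_n E n ->
  exists n p, K p /\ \forall x \near p, K x -> E n x.
Proof.
move=> cK [p0 Kp0] Eclosed KE; apply: contrapT => nE.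
have step (z : nat * (R * R)) : exists w : R * R, K z.2.1 -> 0 < z.2.2 ->
    [/\ K w.1, 0 < w.2 & forall x, `|x - w.1| <= w.2 ->
      `|x - z.2.1| <= z.2.2 /\ (K x -> ~ E z.1 x)].
  case: z => n [p r] /=; have [Kp|?] := pselect (K p); last by exists (p, r).
  have [r0|?] := pselect (0 < r); last by exists (p, r).
  have [q [qr Kq nEq]] : exists q, [/\ `|q - p| < r / 2, K q & ~ E n q].
    apply: contrapT => nq; apply: nE; exists n, p; split=> //.
    near=> x => Kx; apply: contrapT => nEx; apply: nq; exists x; split=> //.
    rewrite distrC; near: x; apply: cvgr_dist_lt; rewrite ?divr_gt0//.
  have /nbhs_ballP[d /= d0 dE] := Eclosed _ _ Kq nEq.
  (* [r / 2] keeps the new ball inside the old one, as [|q - p| < r / 2]; [d / 2] fits the closed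
     ball into the open ball of radius [d]. *)
  exists (q, Num.min (r / 2) (d / 2)) => _ _ /=; split=> //.
    by rewrite lt_min !divr_gt0.
  move=> x; rewrite le_min => /andP[xr xd]; split.
    rewrite -(subrK q x) -addrA (le_trans (ler_normD _ _))//; lra.
  by apply: dE; rewrite /ball/= distrC; lra.
have [f Hf] := choice step.
pose z := fix z m := if m is m'.+1 then f (m', z m') else (p0, 1).
have zK m : K (z m).1 /\ 0 < (z m).2.
  by elim: m => [//|m [Km m0]]; have [//|//|] := Hf (m, z m).
have zS m x : `|x - (z m.+1).1| <= (z m.+1).2 ->
    `|x - (z m).1| <= (z m).2 /\ (K x -> ~ E m x).
  by have [Km m0] := zK m; have [//|//|_ _] := Hf (m, z m); exact.
have nested m n x : `|x - (z (n + m)%N).1| <= (z (n + m)%N).2 ->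
    `|x - (z m).1| <= (z m).2.
  by elim: n => [//|n IH]; rewrite addSn => /zS[] /IH.
have [t [Kt ct]] := cK ((fun m => (z m).1) @ \oo) _
  (filterE _ (fun m => (zK m).1)).
have tz m : `|t - (z m).1| <= (z m).2.
  rewrite leNgt; apply/negP => ltm.
  have [||x [xm /lt_geF]] := ct [set x | `|x - (z m).1| <= (z m).2]
      [set x | (z m).2 < `|x - (z m).1|].
  - exists m => // n /= mn; rewrite -(subnK mn).
    by apply: (@nested _ (n - m)%N); rewrite subrr normr0 ltW// (zK _).2.
  - have : `|x - (z m).1| @[x --> t] --> `|t - (z m).1|.
      by apply: cvg_norm; apply: cvgB; [exact: cvg_id|exact: cvg_cst].
    by move=> /cvgr_gt /(_ _ ltm).
  - by rewrite xm.
have [n _ Ent] := KE _ Kt.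
by have [_ /(_ Kt)] := zS n t (tz n.+1).
Unshelve. all: by end_near. Qed.

Lemma compact_locally_bounded (R : realType) (A K : set R) (h : nat -> R -> R) :
  compact K -> K `<=` A ->
  (forall t, K t ->
    exists M : R, \forall x \near t, A x -> forall k, `|h k x| <= M) ->
  exists M : R, forall x k, K x -> `|h k x| <= M.
Proof.
move=> cK KA locM.
have /near_covering_withinP covK := (compact_near_coveringP K).1 cK.
have : \forall M \near +oo, K `<=` [set x | forall k, `|h k x| <= M].
  apply: covK => t Kt; have [M hM] := locM t Kt.
  exists ([set x | A x -> forall k, `|h k x| <= M], [set N | M <= N]).
    by split=> //; exact: nbhs_pinfty_ge (num_real M).
  move=> [x N] /= [xM MN] Kx k.
  by rewrite (le_trans _ MN)// xM//; exact: KA.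
move=> /(@filter_ex _ _ _)[M KM].
by exists M => x k Kx; exact: KM.
Qed.

(** * Boundedness and vanishing of derivative chains *)

(** Meant for the gap between [x] and a nearest bad point [q]: [q] joins the ball, while the
    opposite endpoint, possibly bad too, stays out. *)
Lemma is_interval_ballU1 (R : realType) (x q : R) :
  is_interval [set z | `|z - x| < `|q - x| \/ z = q].
Proof.
move=> u v /= ux vx w /andP[uw wv].
have [->|] := eqVneq w q; [by right|rewrite neq_lt => wq; left].
have [qx|qx] := leP 0 (q - x); rewrite ?(ger0_norm qx) ?(ltr0_norm qx) in ux vx *.
  have {ux} xu : 2 * x - q < u \/ u = q by move: ux; rewrite ltr_norml; lra.
  have {vx} vq : v <= q by move: vx; rewrite ltr_norml; lra.
  by rewrite ltr_norml; lra.
have {vx} xv : v < 2 * x - q \/ v = q by move: vx; rewrite ltr_norml; lra.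
have {ux} uq : q <= u by move: ux; rewrite ltr_norml; lra.
by rewrite ltr_norml; lra.
Qed.

(* Suppose some points are bad, i.e. the chain is unbounded near them. By Baire,
   |h k| <= n holds for all k at the bad points near some bad p. If x near p is
   not bad and q is a bad point closest to x, absorption based at x bounds the
   chain on the gap up to q, which permits absorption based at q: the bound 2n
   at x depends on q only, so p was not bad. *)
Lemma derivative_chain_locally_bounded (R : realType) (a b C : R)
    (h : nat -> R -> R) :
  0 <= C ->
  (forall k t, t \in `[a, b] ->
    diff_quotient (h k) t s @[s --> within `[a, b] t^'] --> C * h k.+1 t) ->
  (forall t, t \in `[a, b] -> exists N : R, forall k, `|h k t| <= N) ->
  forall t, t \in `[a, b] ->
    exists M : R, \forall x \near t, x \in `[a, b] -> forall k, `|h k x| <= M.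
Proof.
move=> C0 dh hN.
pose good (t : R) := exists M : R, \forall x \near t,
  x \in `[a, b] -> forall k, `|h k x| <= M.
pose K := `[a, b] `&` ~` good.
have cK : compact K.
  apply: (@subclosed_compact _ _ `[a, b]); last exact: subIsetl.
    apply: closedI; first exact: interval_closed.
    apply: open_closedC; rewrite openE => t [M /near_join tM].
    by apply: filterS tM => x xM; exists M.
  exact: segment_compact.
suff K0 : K = set0.
  move=> t tab; apply: contrapT => ngood.
  by have : K t by []; rewrite K0.
apply: contrapT => /eqP/set0P K0.
pose E (n : nat) := [set t | forall k, `|h k t| <= n%:R].
have [||n [p [[pab badp] pE]]] := compact_Baire cK K0 (E := E).
- move=> n t [tab _] /existsNP[k /negP]; rewrite -ltNge => nk.
  have hk := @diff_quotient_continuous _ _ (h k) _ (dh k).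
  have /subspace_continuousP /(_ t tab) ct := hk.
  have : \forall x \near t, x \in `[a, b] -> n%:R < `|h k x|.
    exact: (cvgr_gt _ (cvg_norm ct) _ nk).
  by apply: filterS => x xn [xab _] /(_ k); apply/negP; rewrite -ltNge xn.
- move=> t [tab _]; have [N hNt] := hN t tab.
  exists (Num.bound `|N|) => // k; rewrite (le_trans (hNt k))//.
  by rewrite (le_trans (ler_norm _))// ltW// archi_boundP.
have /nbhs_ballP[d /= d0 dE] := pE.
apply: (badp); exists (2 * n%:R).
(* The intervals below lie within [|p - x|] of [x], so absorption on them needs
   [4 * C * |p - x| <= 1]. Using [C + 1] keeps the divisor positive if [C = 0]. *)
have C1 : 0 < 4 * (C + 1) by lra.
near=> x => xab.
have xd : `|p - x| < d / 2.
  by near: x; apply: cvgr_dist_lt; rewrite ?divr_gt0//.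
have xC : `|p - x| * (4 * (C + 1)) < 1.
  by rewrite -ltr_pdivlMr//; near: x; apply: cvgr_dist_lt; rewrite ?divr_gt0//.
have Cx : 4 * C * `|p - x| <= 1 by have := normr_ge0 (p - x); nra.
have [badx k|/not_andP[//|/contrapT goodx]] := pselect (K x).
  rewrite (@le_trans _ _ n%:R)//; last by rewrite ler_peMl// ler1n.
  by apply: dE => //; rewrite /ball/=; lra.
(* Since [|q - x| <= |p - x| < d / 2], the nearest bad point [q] lies within [d] of [p], where bad
   points satisfy the bound [n]. *)
have [q /set_mem Kq qmin] : exists2 q, q \in K &
    forall y, y \in K -> `|q - x| <= `|y - x|.
  apply: (@compact_EVT_min _ _ (fun y => `|y - x|) K) => //.
  apply: continuous_subspaceT => y.
  by apply: cvg_norm; apply: cvgB; [exact: cvg_id|exact: cvg_cst].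
have [qab badq] := Kq.
have qp : `|q - x| <= `|p - x| by apply: qmin; exact: mem_set (conj pab badp).
have Eq k : `|h k q| <= n%:R.
  apply: dE => //; rewrite /ball/= -(subrK x p) -addrA.
  by rewrite (le_lt_trans (ler_normD _ _))// (distrC x); lra.
have q0 : 0 < `|q - x|.
  by rewrite normr_gt0 subr_eq0; apply: contra_notN badq => /eqP ->.
have gap y : y \in `[a, b] -> `|y - x| < `|q - x| -> good y.
  move=> yab yq; apply: contrapT => bady.
  by have := qmin y (mem_set (conj yab bady)); rewrite leNgt yq.
have [N hNx] := hN x xab.
have open_gap y k : y \in `[a, b] -> `|y - x| < `|q - x| -> `|h k y| <= 2 * N.
  move=> yab yq.
  (* This closed interval contains no bad point, so compactness gives some [M]; absorption based at
     [x] trades it for [2 * N], uniformly over the open gap. *)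
  pose I := `[a, b] `&` [set z | `|z - x| <= `|y - x|].
  have [M IM] : exists M, forall z k, I z -> `|h k z| <= M.
    apply: (@compact_locally_bounded _ `[a, b] I).
    - apply: (@subclosed_compact _ _ `[a, b]); last exact: subIsetl.
        apply: closedI; first exact: interval_closed.
        apply: (@preimage_closed _ _ (fun z => `|z - x|) [set u | u <= `|y - x|]).
          move=> z _; apply: cvg_norm.
          by apply: cvgB; [exact: cvg_id|exact: cvg_cst].
        exact: closed_le.
      exact: segment_compact.
    - exact: subIsetl.
    - by move=> z [zab zy]; apply: gap => //; exact: le_lt_trans yq.
  apply: (@interval_absorption _ a b C N M x I h) => //.
  - move=> u v [/= + +] [/= + +] w uwv; rewrite /= !in_itv/= => uab + vab.
    rewrite !ler_norml => uy vy; split; first by rewrite /= in_itv/=; lra.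
    by rewrite /= ler_norml; lra.
  - by move=> z [].
  - move=> u v [_ +] [_]; rewrite /= !ler_norml => ux vx.
    have : v - u <= 2 * `|p - x| by lra.
    by have := C0; nra.
  - by split=> //=; rewrite subrr normr0.
  - by split=> /=.
(* The bound [2 * N + n] depends on [x] through [N]; absorption based at [q] replaces it by [2 * n],
   the same for all [x] near [p]. *)
move=> k; pose I := `[a, b] `&` [set z | `|z - x| < `|q - x| \/ z = q].
apply: (@interval_absorption _ a b C n%:R (2 * N + n%:R) q I h) => //.
- move=> u v [uab ux] [vab vx] w uwv; split.
    exact: (interval_is_interval uab vab uwv).
  exact: (is_interval_ballU1 ux vx uwv).
- by move=> z [].
- have norm_le z : I z -> `|z - x| <= `|q - x| by case=> _ [/ltW|->].
  move=> u v /norm_le ux /norm_le vx.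
  have : v - u <= 2 * `|p - x| by move: ux vx; rewrite !ler_norml; lra.
  by have := C0; nra.
- have N0 : 0 <= N := le_trans (normr_ge0 _) (hNx 0%N).
  have n0 : 0 <= n%:R :> R by [].
  move=> z j [zab /= [zx|->]]; last by rewrite (le_trans (Eq j)); lra.
  by rewrite (le_trans (open_gap z j zab zx))//; lra.
- by split=> //=; right.
- split=> //=; left; by rewrite subrr normr0.
Unshelve. all: by end_near. Qed.

(** Once all [h k] are uniformly bounded, absorption based at a common zero ([n = 0]) forces
    vanishing on an interval of length up to [1 / (2C)]; finitely many of these lead from [b] to any
    [t]. *)
Lemma derivative_chain_eq0 (R : realType) (a b C : R) (h : nat -> R -> R) :
  0 < C ->
  (forall k t, t \in `[a, b] ->
    diff_quotient (h k) t s @[s --> within `[a, b] t^'] --> C * h k.+1 t) ->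
  (forall t, t \in `[a, b] -> exists N : R, forall k, `|h k t| <= N) ->
  (forall k, h k b = 0) ->
  forall k t, t \in `[a, b] -> h k t = 0.
Proof.
move=> C0 dh hN hb.
have locM := derivative_chain_locally_bounded (ltW C0) dh hN.
have [M hM] : exists M : R, forall t k, t \in `[a, b] -> `|h k t| <= M.
  apply: (@compact_locally_bounded _ `[a, b] `[a, b]) => //.
  exact: segment_compact.
have vanish m : forall k t, t \in `[a, b] -> 2 * C * (b - t) <= m%:R ->
    h k t = 0.
  elim: m => [|m IH] k t; rewrite in_itv/= => tab tm.
    suff -> : t = b by exact: hb.
    have : C * (b - t) <= 0 by lra.
    by rewrite pmulr_rle0//; lra.
  (* [s] ends the first of [m + 1] equal parts of [[t, b]]: that part is short enough for
     absorption, and [[s, b]] falls under the induction hypothesis. *)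
  pose s := t + (b - t) / m.+1%:R.
  have m0 : 0 < m.+1%:R :> R by rewrite ltr0n.
  have ts : 0 <= (b - t) / m.+1%:R by apply: divr_ge0 => //; lra.
  have sb : b - s = m%:R * ((b - t) / m.+1%:R).
    by rewrite /s; field; apply: lt0r_neq0.
  have sb0 : s <= b by rewrite -subr_ge0 sb mulr_ge0.
  have {}ts : t <= s by rewrite /s lerDl.
  have len : 2 * C * (s - t) <= 1.
    by rewrite /s [t + _]addrC addrK mulrA ler_pdivrMr// mul1r (le_trans tm).
  apply/eqP; rewrite -normr_le0 -(mulr0 2).
  apply: (@interval_absorption _ a b C 0 M s `[t, s] h) => //; first exact: ltW.
  - exact: interval_is_interval.
  - by move=> z /=; rewrite !in_itv/=; lra.
  - by move=> x y; rewrite /= !in_itv/= => xt yt; nra.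
  - by move=> x j /=; rewrite in_itv/= => xt; apply: hM; rewrite in_itv/=; lra.
  - by rewrite /= in_itv/=; lra.
  - move=> j; rewrite IH ?normr0//; first by rewrite in_itv/=; lra.
    rewrite sb mulrCA ler_piMr//.
    by move: len; rewrite /s [t + _]addrC addrK.
  - by rewrite /= in_itv/=; lra.
move=> k t tab; apply: (vanish (Num.bound `|2 * C * (b - t)|)) => //.
by rewrite (le_trans (ler_norm _))// ltW// archi_boundP.
Qed.

(** * Square-summability and the operator [Delta + c] *)

(** [M] bounds the squared norm in [l^2(mu)]; testing it on finite lists keeps the operator
    estimates within finite real sums. *)
Definition l2_le (R : realType) (V : choiceType) (G : weighted_graph R V)
    (M : R) (f : V -> R) : Prop :=
  forall S : seq V, uniq S -> \sum_(x <- S) f x ^+ 2 * vertex_weight G x <= M.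

Lemma W12_l2_le (R : realType) (V : choiceType) (G : weighted_graph R V)
    (f : V -> R) :
  W12 G f -> exists M, l2_le G M f.
Proof.
rewrite /W12/=; set Q := (esum _ _) => Qoo.
have SQ (S : seq V) : uniq S ->
    ((\sum_(x <- S) f x ^+ 2 * vertex_weight G x)%:E <= Q)%E.
  move=> uS; apply: esum_ge; exists [set` S]; first by split.
  by rewrite -fsbig_seq// sumEFin.
exists (fine Q) => S uS; rewrite -lee_fin fineK ?SQ//.
by rewrite ge0_fin_numE// (le_trans _ (SQ [::] _))// big_nil.
Qed.

Definition neighbors (R : realType) (V : choiceType) (G : weighted_graph R V)
    (x : V) : seq V := finmap.enum_fset (fset_set [set y | edge G x y]).

Section WeightedGraph.
Context {R : realType} {V : choiceType} (G : weighted_graph R V).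
Implicit Types (x y : V) (f : V -> R).
Local Notation mu := (vertex_weight G).
Local Notation nb := (neighbors G).

Lemma neighbors_uniq x : uniq (nb x).
Proof. exact: finmap.fset_uniq. Qed.

Lemma mem_neighbors x y : (y \in nb x) = edge G x y.
Proof.
rewrite (in_fset_set (edge_locally_finite G x)).
by apply/idP/idP => [/set_mem|/mem_set].
Qed.

Lemma vertex_weightE x : mu x = \sum_(y <- nb x) weight G x y.
Proof. exact: fsbig_finite (edge_locally_finite G x). Qed.

Lemma laplacianE f x :
  laplacian G f x = \sum_(y <- nb x) weight G x y / mu x * (f y - f x).
Proof. exact: fsbig_finite (edge_locally_finite G x). Qed.

Lemma neighbor_weight_ge0 x y : y \in nb x -> 0 <= weight G x y.
Proof. by rewrite mem_neighbors => /weight_gt0/ltW. Qed.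

Lemma vertex_weight_ge0 x : 0 <= mu x.
Proof.
by rewrite vertex_weightE big_seq sumr_ge0// => y; exact: neighbor_weight_ge0.
Qed.

Lemma neighbors_eq0 x : mu x = 0 -> nb x = [::].
Proof.
rewrite vertex_weightE => mu0; case E : (nb x) => [//|y s].
have yx : y \in nb x by rewrite E mem_head.
have := weight_gt0 (etrans (esym (mem_neighbors x y)) yx).
suff -> : weight G x y = 0 by rewrite ltxx.
move/eqP : mu0; rewrite big_seq psumr_eq0; last exact: neighbor_weight_ge0.
by move=> /allP /(_ y yx); rewrite yx => /eqP.
Qed.

(** Jensen's inequality: [m] is the mean of [f y - f x] for the probabilities [w_xy / mu x], and the
    variance about [m] is nonnegative. *)
Lemma laplacian_sqr_le f x :
  mu x * laplacian G f x ^+ 2 <= \sum_(y <- nb x) weight G x y * (f y - f x) ^+ 2.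
Proof.
have [mu0|mu0] := eqVneq (mu x) 0.
  by rewrite mu0 mul0r neighbors_eq0// big_nil.
set m := laplacian G f x.
have mE : mu x * m = \sum_(y <- nb x) weight G x y * (f y - f x).
  rewrite /m laplacianE mulr_sumr; apply: eq_bigr => y _.
  by rewrite mulrA mulrCA divff// mulr1.
have : 0 <= \sum_(y <- nb x) weight G x y * (f y - f x - m) ^+ 2.
  rewrite big_seq sumr_ge0// => y /neighbor_weight_ge0 w0.
  by rewrite mulr_ge0// sqr_ge0.
have -> : \sum_(y <- nb x) weight G x y * (f y - f x - m) ^+ 2 =
    \sum_(y <- nb x) weight G x y * (f y - f x) ^+ 2 - mu x * m ^+ 2.
  transitivity (\sum_(y <- nb x) (weight G x y * (f y - f x) ^+ 2
    - 2 * m * (weight G x y * (f y - f x)) + m ^+ 2 * weight G x y)).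
    by apply: eq_bigr => y _; ring.
  by rewrite big_split/= sumrB -!mulr_sumr -mE -vertex_weightE; ring.
by rewrite subr_ge0.
Qed.

(** After exchanging the sums, [f y ^+ 2] carries the weights between [y] and its neighbours in [S],
    in total at most [mu y]; [T] lists every [y] that occurs. *)
Lemma sum_neighbors_sqr_le M f (S : seq V) : l2_le G M f -> uniq S ->
  \sum_(x <- S) \sum_(y <- nb x) weight G x y * f y ^+ 2 <= M.
Proof.
move=> fM uS; pose T := undup (flatten (map nb S)).
have -> : \sum_(x <- S) \sum_(y <- nb x) weight G x y * f y ^+ 2 =
    \sum_(y <- T) f y ^+ 2 * \sum_(x <- S | edge G x y) weight G x y.
  transitivity (\sum_(x <- S) \sum_(y <- T | edge G x y) weight G x y * f y ^+ 2).
    apply: eq_big_seq => x xS; rewrite -[RHS]big_filter; apply: perm_big.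
    apply: uniq_perm; [exact: neighbors_uniq|exact/filter_uniq/undup_uniq|].
    move=> y; rewrite mem_filter mem_neighbors mem_undup.
    have [xy|//] := boolP (edge G x y); apply/esym/flattenP.
    by exists (nb x); [exact: map_f | rewrite mem_neighbors].
  under eq_bigr do rewrite big_mkcond.
  rewrite exchange_big; apply: eq_bigr => y _.
  rewrite -big_mkcond mulr_sumr; apply: eq_bigr => x _; exact: mulrC.
apply: le_trans (fM T (undup_uniq _)); apply: ler_sum => y _.
rewrite ler_wpM2l ?sqr_ge0// vertex_weightE -[leLHS]big_filter.
rewrite [leRHS](bigID (fun x => x \in S))/= ler_wpDr//.
  by rewrite big_seq_cond sumr_ge0// => x /andP[/neighbor_weight_ge0].
rewrite -[leRHS]big_filter le_eqVlt; apply/orP; left; apply/eqP.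
rewrite (perm_big [seq x <- nb y | x \in S]); last first.
  apply: uniq_perm; try exact/filter_uniq; first exact/filter_uniq/neighbors_uniq.
  by move=> x; rewrite !mem_filter mem_neighbors edge_sym andbC.
apply: eq_big_seq => x; rewrite mem_filter mem_neighbors => /andP[_ yx].
by rewrite [RHS]weight_sym.
Qed.

Definition schrodinger (c : V -> R) f x : R := laplacian G f x + c x * f x.

(** Two uses of [(p + q)^2 <= 2p^2 + 2q^2] give the pointwise bound; summed over [S], its two terms
    contribute at most [4M] and [(4 + 2K^2)M]. *)
Lemma schrodinger_l2_le (c : V -> R) K M f :
  (forall x, `|c x| <= K) -> l2_le G M f ->
  l2_le G ((8 + 2 * K ^+ 2) * M) (schrodinger c f).
Proof.
move=> cK fM S uS.
have ptwise x : schrodinger c f x ^+ 2 * mu x <=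
    4 * (\sum_(y <- nb x) weight G x y * f y ^+ 2) +
    (4 + 2 * K ^+ 2) * (f x ^+ 2 * mu x).
  have lap : mu x * laplacian G f x ^+ 2 <=
      2 * (\sum_(y <- nb x) weight G x y * f y ^+ 2) + 2 * (f x ^+ 2 * mu x).
    apply: (le_trans (laplacian_sqr_le f x)).
    rewrite [X in f x ^+ 2 * X]vertex_weightE !mulr_sumr -big_split/=.
    rewrite !big_seq; apply: ler_sum => y /neighbor_weight_ge0 w0.
    have := mulr_ge0 w0 (sqr_ge0 (f y + f x)); nra.
  have cf : c x ^+ 2 * (f x ^+ 2 * mu x) <= K ^+ 2 * (f x ^+ 2 * mu x).
    apply: ler_wpM2r; first by rewrite mulr_ge0 ?sqr_ge0 ?vertex_weight_ge0.
    by rewrite -real_normK ?num_real// lerXn2r ?nnegrE// (le_trans _ (cK x)).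
  have := mulr_ge0 (vertex_weight_ge0 x) (sqr_ge0 (laplacian G f x - c x * f x)).
  rewrite /schrodinger; nra.
apply: (le_trans (ler_sum _ (fun x _ => ptwise x))).
rewrite big_split/= -!mulr_sumr.
have := sum_neighbors_sqr_le fM uS; have := fM S uS.
have := sqr_ge0 K; nra.
Qed.

(* When mu x = 0 the l2 bound says nothing at x, but then x has no neighbor and
   the operator is multiplication by c x there. *)
Lemma iter_schrodinger_le (c : V -> R) K M f x :
  (forall x, `|c x| <= K) -> l2_le G M f ->
  exists N, forall k,
    `|iter k (schrodinger c) f x / (8 + 2 * K ^+ 2) ^+ k| <= N.
Proof.
move=> cK fM; set D := 8 + _.
have K2 : 0 <= K ^+ 2 := sqr_ge0 K.
have D1 : 1 <= D by rewrite /D; lra.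
have D0 : 0 < D by lra.
have Dk k : 0 < D ^+ k by rewrite exprn_gt0.
have [mu0|mu0] := eqVneq (mu x) 0.
  exists `|f x| => k; rewrite normf_div (ger0_norm (ltW (Dk k))) ler_pdivrMr//.
  elim: k => [|k IH]; first by rewrite mulr1.
  rewrite iterS /schrodinger laplacianE neighbors_eq0// big_nil add0r normrM.
  rewrite exprS mulrCA ler_pM// (le_trans (cK x))// /D; nra.
have {}mu0 : 0 < mu x by rewrite lt_neqAle eq_sym mu0 vertex_weight_ge0.
have itM k : l2_le G (D ^+ k * M) (iter k (schrodinger c) f).
  elim: k => [|k IH]; first by rewrite mul1r.
  by rewrite iterS exprS -mulrA; exact: schrodinger_l2_le.
(* The squared iterate grows at most like [D ^+ k] but is divided by [D ^+ (2k)], so [D >= 1] leaves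
   [M / mu x]. *)
exists (Num.sqrt (M / mu x)) => k.
rewrite -sqrtr_sqr ler_wsqrtr// expr_div_n ler_pdivrMr ?exprn_gt0//.
rewrite mulrAC ler_pdivlMr//.
have := itM k [:: x] isT; rewrite big_seq1 => /le_trans; apply.
rewrite mulrC ler_wpM2l//; last by rewrite expr2 ler_peMl ?exprn_ege1// ltW.
have := fM [:: x] isT; rewrite big_seq1; apply: le_trans.
by rewrite mulr_ge0 ?sqr_ge0 ?vertex_weight_ge0.
Qed.

(** By local finiteness the operator at [x] is a finite linear combination of values, so it commutes
    with difference quotients and their limits. *)
Lemma schrodinger_diff_quotient (c : V -> R) (A : set R)
    (v v' : V -> R -> R) (t : R) :
  (forall x, diff_quotient (v x) t s @[s --> within A t^'] --> v' x t) ->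
  forall x, diff_quotient (fun s => schrodinger c (v^~ s) x) t s
    @[s --> within A t^'] --> schrodinger c (v'^~ t) x.
Proof.
move=> dv x.
have -> : diff_quotient (fun s => schrodinger c (v^~ s) x) t =
    fun s => schrodinger c (fun y => diff_quotient (v y) t s) x.
  apply/funext => s; rewrite /schrodinger/diff_quotient !laplacianE.
  rewrite opprD addrACA -sumrB mulrDl mulr_suml; congr (_ + _); last by ring.
  by apply: eq_bigr => y _; ring.
rewrite /schrodinger; apply: cvgD; last by apply: cvgM => //; exact: cvg_cst.
rewrite laplacianE; under eq_fun do rewrite laplacianE.
apply: cvg_big => [|y _]; first by apply: add_continuous.
by apply: cvgM; [exact: cvg_cst|apply: cvgB].
Qed.

End WeightedGraph.

(** * Vanishing of the solution *)

Theorem theorem1p4 (R : realType) (V : choiceType) (G : weighted_graph R V)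
    (a b : R) (u : V -> R -> R) (c : V -> R) :
  a < b ->
  (forall x, C1_within `[a, b] (u x)) ->
  (forall t, t \in `[a, b] -> W12 G (fun x => u x t)) ->
  (forall t, t \in `[a, b] ->
    W12 G (fun x => derive_within `[a, b] (u x) t)) ->
  [bounded c x | x in [set: V]] ->
  (forall x t, t \in `[a, b] ->
    derive_within `[a, b] (u x) t
      = laplacian G (fun y => u y t) x + c x * u x t) ->
  (forall x, u x b = 0) ->
  forall x t, t \in `[a, b] -> u x t = 0.
Proof.
move=> ab uC1 uW _ [K [_ cK]] eqn ub x0.
(* Boundedness supplies the estimate only for constants strictly above [K]. *)
have {}cK x : `|c x| <= K + 1 by apply: cK => //; rewrite ltrDl.
pose D := 8 + 2 * (K + 1) ^+ 2.
have D0 : 0 < D by rewrite /D; have := sqr_ge0 (K + 1); lra.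
pose v k x t := iter k (schrodinger G c) (u^~ t) x.
(* The induction runs over all vertices at once, since the operator at [x] involves the neighbours;
   the first derivative comes from the equation. *)
have dv k x t : t \in `[a, b] ->
    diff_quotient (v k x) t s @[s --> within `[a, b] t^'] --> v k.+1 x t.
  move=> tab; elim: k x => [|k IH] x.
    have := (uC1 x).1 t tab; rewrite /derivable_within => duxt.
    by have -> : v 1%N x t = derive_within `[a, b] (u x) t by rewrite eqn.
  exact: schrodinger_diff_quotient IH x.
pose h k t := v k x0 t / D ^+ k.
suff h0 : forall k t, t \in `[a, b] -> h k t = 0.
  by move=> t tab; have := h0 0%N t tab; rewrite /h expr0 divr1.
apply: (@derivative_chain_eq0 _ a b D) => //.
- move=> k t tab.
  have -> : diff_quotient (h k) t = fun s => diff_quotient (v k x0) t s / D ^+ k.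
    by apply/funext => s; rewrite /diff_quotient /h; ring.
  have -> : D * h k.+1 t = v k.+1 x0 t / D ^+ k.
    by rewrite /h exprS; field; rewrite expf_neq0 ?gt_eqF.
  by apply: cvgM; [exact: dv|exact: cvg_cst].
- move=> t tab; have [M uM] := W12_l2_le (uW t tab).
  exact: iter_schrodinger_le uM.
- move=> k; suff vb : forall x, v k x b = 0 by rewrite /h vb mul0r.
  elim: k => [//|k IH] x; rewrite -[LHS]/(schrodinger G c ((v k)^~ b) x).
  rewrite /schrodinger laplacianE IH mulr0 addr0.
  by rewrite big1// => y _; rewrite IH subrr mulr0.
Qed.
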